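(* Let $n\ge1$, $a_0,a_1\in\mathbb{R}$, and let $c_0,\dots,c_n$ be real constants with $c_{k-1}=a_1c_k-a_0c_{k+1}$ for $k=1,\dots,n-1$. Let $F(p_1,\dots,p_n)=\sum_{k=0}^nc_k\sigma_k(p)$ and consider the ODE system $$\frac{p_i''}{2}\,F(p_1,\dots,p_n)=(p_i')^2\,\frac{\partial F}{\partial p_i}(p_1,\dots,p_n),\qquad i=1,\dots,n,$$ for real-valued $C^2$ functions $p_1(s),\dots,p_n(s)$ on an interval, with $p_i'\ne0$ for all $i$ and $F(p_1,\dots,p_n)\neq0$ along the solution. Define $$\xi_i=\frac{p_i^2+a_1p_i+a_0}{p_i'},\qquad i=1,\dots,n.$$ Then $\xi_i-\xi_1$, $i=2,\dots,n$, are first integrals of the system. In addition, the $\xi_i$ satisfy $$(\xi_i')^2=(a_1^2-4a_0)+\frac{4}{\kappa}\bigl(c_{n-1}^2-a_1c_{n-1}c_n+a_0c_n^2\bigr)\prod_{j=1}^n\xi_j,\qquad i=1,\dots,n,$$ where $\kappa$ is the constant such that $F^2=\kappa\,p_1'\cdots p_n'$ along the solution.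
   Context: $\sigma_k(p)$ is the $k$-th elementary symmetric polynomial of $p_1,\dots,p_n$ ($\sigma_0=1$); primes denote $d/ds$. A first integral is a function of $(p_i,p_i')$ that is constant along every solution. The quantity $F^2/(p_1'\cdots p_n')$ is a first integral of the system (for arbitrary coefficients $c_k$), so the constant $\kappa$ exists for each solution. *)

(* Defs.v *)
From HB Require Import structures.
From mathcomp Require Import all_boot all_order all_algebra.
From mathcomp Require Import all_classical all_reals all_analysis.
(* The notations of [mpoly] clash with those of mathcomp-analysis; only its
   canonical structures are needed. *)
From mathcomp Require Import -(notations) mpoly.
Set Implicit Arguments.
Unset Strict Implicit.
Unset Printing Implicit Defensive.
Import Order.TTheory GRing.Theory Num.Theory.
Import numFieldNormedType.Exports.
Local Open Scope classical_set_scope.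
Local Open Scope ring_scope.

(* Intervals of any kind (open, closed, half-open, unbounded), but not empty
   or reduced to a point, so that derivatives on them are meaningful. *)
Definition proper_interval (R : realType) (J : set R) : Prop :=
  is_interval J /\ exists x y : R, [/\ J x, J y & x < y].

(* The limit is taken within J: the derivative is two-sided at interior points
   of J and one-sided at an endpoint belonging to J. *)
Definition is_derivative_on (R : realType) (J : set R) (f df : R -> R) : Prop :=
  forall s : R, J s ->
    (fun t : R => (f t - f s) / (t - s)) @ within J (dnbhs s) --> df s.

(* [mesym n R k] is the k-th elementary symmetric polynomial in n variables;
   only the values c 0, ..., c n are used. *)
Definition Fpoly (R : realType) (n : nat) (c : nat -> R) : @mpoly n R :=
  \sum_(k < n.+1) c k *: mesym n R k.

Definition Feval (R : realType) (n : nat) (c : nat -> R) (x : 'I_n -> R) : R :=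
  meval x (Fpoly n c).

Definition dFeval (R : realType) (n : nat) (c : nat -> R) (i : 'I_n)
    (x : 'I_n -> R) : R :=
  meval x (mderiv i (Fpoly n c)).

(* p' and p'' are the first and second derivatives of p on J. *)
Record is_solution (R : realType) (n : nat) (c : nat -> R) (J : set R)
    (p p' p'' : 'I_n -> R -> R) : Prop := IsSolution {
  sol_deriv1 : forall i, is_derivative_on J (p i) (p' i);
  sol_deriv2 : forall i, is_derivative_on J (p' i) (p'' i);
  sol_cont2 : forall i, {within J, continuous (p'' i)};
  sol_p'_neq0 : forall i s, J s -> p' i s != 0;
  sol_F_neq0 : forall s, J s -> Feval c (p ^~ s) != 0;
  sol_ode : forall i s, J s ->
    p'' i s / 2 * Feval c (p ^~ s) = p' i s ^+ 2 * dFeval c i (p ^~ s)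
}.

(* Phi is a function of (p_1, ..., p_n) and (p_1', ..., p_n'). *)
Definition is_first_integral (R : realType) (n : nat) (c : nat -> R)
    (Phi : ('I_n -> R) -> ('I_n -> R) -> R) : Prop :=
  forall (J : set R) (p p' p'' : 'I_n -> R -> R),
    proper_interval J -> is_solution c J p p' p'' ->
    forall s t : R, J s -> J t ->
      Phi (p ^~ s) (p' ^~ s) = Phi (p ^~ t) (p' ^~ t).

Definition xi (R : realType) (n : nat) (a0 a1 : R) (i : 'I_n)
    (x y : 'I_n -> R) : R :=
  (x i ^+ 2 + a1 * x i + a0) / y i.

(* Main.v *)
(* F is affine in each variable: F = A + p_i B with B = dF/dp_i, where A and B
   involve only the other variables. Eliminating p_i'' gives
   F xi_i' = (2 p_i + a1) F - 2 (p_i^2 + a1 p_i + a0) B,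
   and the recurrence on the c_k makes this expression symmetric in i and j, so
   xi_i' does not depend on i. Completing the square,
   F^2 (xi_i'^2 - a1^2 + 4 a0) = 4 (p_i^2 + a1 p_i + a0) (A^2 - a1 A B + a0 B^2),
   and the last factor, a norm form, is multiplicative along the recursion that
   removes the remaining variables one at a time. *)
Require Import Defs.
From mathcomp Require Import all_boot all_order all_algebra.
From mathcomp Require Import all_classical all_reals all_analysis.
From mathcomp Require Import -(notations) mpoly.
From mathcomp Require Import ring.
Import Order.TTheory GRing.Theory Num.Theory.
Import numFieldNormedType.Exports.
Local Open Scope classical_set_scope.
Local Open Scope ring_scope.

Set Implicit Arguments.
Unset Strict Implicit.

Lemma mderivXU (K : nzRingType) (n : nat) (i j : 'I_n) :
  mderiv j (mpolyX K (mnm1 i)) = (i == j)%:R.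
Proof.
rewrite mderivX mnm1E; have [->|_] := eqVneq i j; last by rewrite scale0r.
by rewrite scale1r -[X in mnm_sub X](add0m (mnm1 j)) addmK mpolyX0.
Qed.

(** * Calculus of derivatives relative to an interval *)

Section DerivativeOn.
Variables (R : realType) (J : set R).
Implicit Types f g df dg : R -> R.

Lemma is_derivative_on_ext f g df dg :
  {in J, f =1 g} -> {in J, df =1 dg} ->
  is_derivative_on J f df -> is_derivative_on J g dg.
Proof.
move=> efg ed Df s Js.
rewrite -ed ?inE//; apply: cvg_trans (Df s Js); apply: near_eq_cvg.
near=> t; rewrite !efg ?inE//.
by near: t; rewrite near_withinE; near=> t.
Unshelve. all: by end_near. Qed.

Lemma is_derivative_on_continuous f df s :
  is_derivative_on J f df -> J s -> f t @[t --> within J (dnbhs s)] --> f s.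
Proof.
move=> Df Js.
(* This also holds at [t = s], where the quotient is multiplied by zero. *)
have -> : f = (fun t => (f t - f s) / (t - s) * (t - s) + f s).
  apply/funext => t; have [->|ts] := eqVneq t s; first by rewrite !subrr mulr0 add0r.
  by rewrite divfK ?subr_eq0// subrK.
rewrite -[X in _ --> X](_ : df s * (s - s) + f s = _); last first.
  by rewrite subrr mulr0 add0r subrr mulr0 add0r.
apply: cvgD; last exact: cvg_cst.
apply: cvgM; first exact: Df.
apply: cvgB; last exact: cvg_cst.
apply: cvg_trans; first exact: cvg_within.
exact: nbhs_dnbhs.
Qed.

Lemma is_derivative_on_cst (a : R) : is_derivative_on J (cst a) (cst 0).
Proof.
move=> s _; under eq_fun do rewrite /= subrr mul0r.
exact: cvg_cst.
Qed.

Lemma is_derivative_onD f g df dg :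
  is_derivative_on J f df -> is_derivative_on J g dg ->
  is_derivative_on J (f \+ g) (df \+ dg).
Proof.
move=> Df Dg s Js.
have -> : (fun t => ((f \+ g) t - (f \+ g) s) / (t - s)) =
    (fun t => (f t - f s) / (t - s) + (g t - g s) / (t - s)).
  by apply/funext => t /=; ring.
by apply: cvgD; [exact: Df|exact: Dg].
Qed.

Lemma is_derivative_onM f g df dg :
  is_derivative_on J f df -> is_derivative_on J g dg ->
  is_derivative_on J (f \* g) (fun t => df t * g t + f t * dg t).
Proof.
move=> Df Dg s Js.
have -> : (fun t => ((f \* g) t - (f \* g) s) / (t - s)) =
    (fun t => (f t - f s) / (t - s) * g t + f s * ((g t - g s) / (t - s))).
  by apply/funext => t /=; ring.
apply: cvgD; apply: cvgM.
- exact: Df.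
- exact: is_derivative_on_continuous Dg Js.
- exact: cvg_cst.
- exact: Dg.
Qed.

Lemma is_derivative_onV f df :
  (forall s, J s -> f s != 0) -> is_derivative_on J f df ->
  is_derivative_on J (fun t => (f t)^-1) (fun t => - df t / f t ^+ 2).
Proof.
move=> f0 Df s Js.
have -> : - df s / f s ^+ 2 = - df s * (f s)^-1 * (f s)^-1.
  by rewrite expr2 invfM mulrA.
have : - ((f t - f s) / (t - s)) * (f t)^-1 * (f s)^-1
    @[t --> within J (dnbhs s)] --> - df s * (f s)^-1 * (f s)^-1.
  apply: cvgM; last exact: cvg_cst.
  apply: cvgM; first by apply: cvgN; exact: Df.
  by apply: cvgV; [exact: f0|exact: is_derivative_on_continuous Df Js].
(* The two quotients are compared only for [t] in [J] distinct from [s], where [f t] and [t - s] are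
   invertible. *)
apply: cvg_trans; apply: near_eq_cvg; rewrite near_withinE; near=> t => Jt.
have ts : t - s != 0.
  by rewrite subr_eq0; near: t; exact: nbhs_dnbhs_neq.
by field; rewrite ts f0//= f0.
Unshelve. all: by end_near. Qed.

Lemma is_derivative_on_sum (I : Type) (r : seq I) (f df : I -> R -> R) :
  (forall i, is_derivative_on J (f i) (df i)) ->
  is_derivative_on J (fun t => \sum_(i <- r) f i t) (fun t => \sum_(i <- r) df i t).
Proof.
move=> Df; elim: r => [|i r IHr].
  by apply: is_derivative_on_ext (is_derivative_on_cst 0) => t _; rewrite big_nil.
by apply: is_derivative_on_ext (is_derivative_onD (Df i) IHr) => t _;
  rewrite big_cons.
Qed.

(* Logarithmic form of the product rule; it needs no nonvanishing hypothesis. *)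
Lemma is_derivative_on_prod (I : Type) (r : seq I) (f g : I -> R -> R) :
  (forall i, is_derivative_on J (f i) (g i \* f i)) ->
  is_derivative_on J (fun t => \prod_(i <- r) f i t)
    (fun t => (\sum_(i <- r) g i t) * \prod_(i <- r) f i t).
Proof.
move=> Df; elim: r => [|i r IHr].
  apply: is_derivative_on_ext (is_derivative_on_cst 1) => t _.
    by rewrite big_nil.
  by rewrite !big_nil mul0r.
apply: is_derivative_on_ext (is_derivative_onM (Df i) IHr) => t _.
  by rewrite big_cons.
by rewrite !big_cons /=; ring.
Qed.

(** The chain rule for polynomials: the property holds for constants and variables and passes to
    sums and products, hence to monomials and to all polynomials. *)
Lemma is_derivative_on_meval (n : nat) (p p' : 'I_n -> R -> R) (q : mpoly n R) :
  (forall i, is_derivative_on J (p i) (p' i)) ->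
  is_derivative_on J (fun t => meval (p ^~ t) q)
    (fun t => \sum_(i < n) p' i t * meval (p ^~ t) (mderiv i q)).
Proof.
move=> Dp.
pose P (q : mpoly n R) := is_derivative_on J (fun t => meval (p ^~ t) q)
    (fun t => \sum_(i < n) p' i t * meval (p ^~ t) (mderiv i q)).
have PC a : P (mpolyC n a).
  apply: is_derivative_on_ext (is_derivative_on_cst a) => t _.
    by rewrite mevalC.
  by rewrite big1// => i _; rewrite mderivC raddf0 mulr0.
have PD q1 q2 : P q1 -> P q2 -> P (q1 + q2).
  move=> P1 P2; apply: is_derivative_on_ext (is_derivative_onD P1 P2) => t _ /=.
    by rewrite rmorphD.
  by rewrite -big_split; apply: eq_bigr => i _; rewrite mderivD rmorphD mulrDr.
have PM q1 q2 : P q1 -> P q2 -> P (q1 * q2).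
  move=> P1 P2; apply: is_derivative_on_ext (is_derivative_onM P1 P2) => t _ /=.
    by rewrite rmorphM.
  rewrite mulr_suml mulr_sumr -big_split; apply: eq_bigr => i _ /=.
  by rewrite mderivM rmorphD !rmorphM /=; ring.
have PX i : P (mpolyX R (mnm1 i)).
  apply: is_derivative_on_ext (Dp i) => t _; first by rewrite mevalXU.
  rewrite (bigD1 i)//= big1 => [|j ji]; rewrite mderivXU.
    by rewrite eqxx meval1 mulr1 addr0.
  by rewrite eq_sym (negbTE ji) raddf0 mulr0.
rewrite -/(P q); elim/mpolyind: q => [|a m q _ _ Pq].
  by rewrite -(mpolyC0 n R).
apply: PD => //; rewrite -mul_mpolyC; apply: (PM) => //.
rewrite mpolyXE_id; apply: (big_ind P) => [||i _]; [by rewrite -mpolyC1|exact: PM|].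
by elim: (m i) => [|k IHk]; rewrite ?expr0 ?exprS -?mpolyC1//; exact: PM.
Qed.

Hypothesis itvJ : is_interval J.

(** Bridge to the two-sided derivative required by the mean value theorem. *)
Lemma is_derivative_on_interior f df a b s :
  J a -> J b -> s \in `]a, b[ -> is_derivative_on J f df -> is_derive s 1 f (df s).
Proof.
rewrite in_itv /= => Ja Jb /andP[a_s sb] Df.
have Js : J s by apply: (@itvJ a b) => //; rewrite !ltW.
have lim : h^-1 *: ((f \o shift s) (h *: 1) - f s) @[h --> 0^'] --> df s.
  (* For small nonzero [h], the point [h + s] lies in []a, b[], hence in [J], and differs from
     [s]. *)
  have sh : (h + s) @[h --> 0^'] --> within J (dnbhs s).
    have nbhs_shift (P : set R) : nbhs s P -> \forall h \near 0, P (h + s).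
      by move=> sP; have := near_shift 0 s P; rewrite subr0 => <-.
    move=> A sA; have sab : s \in `]a, b[ by rewrite in_itv /= a_s.
    have sA' := nbhs_shift _ sA; have sJ := nbhs_shift _ (near_in_itvoo sab).
    change (\forall h \near 0^', A (h + s)).
    rewrite near_withinE; near=> h => h0.
    have hab : h + s \in `]a, b[ by near: h.
    have : h + s != s -> J (h + s) -> A (h + s) by near: h.
    apply; first by rewrite -subr_eq0 addrK.
    by move: hab; rewrite in_itv /= => /andP[ah hb]; apply: (@itvJ a b) => //; rewrite !ltW.
  have := cvg_comp _ _ sh (Df s Js).
  apply: cvg_trans; apply: near_eq_cvg; near=> h => /=.
  by rewrite addrK /GRing.scale /= mulr1 mulrC.
by apply: DeriveDef; [apply/cvg_ex; exists (df s)|exact: cvg_lim lim].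
Unshelve. all: by end_near. Qed.

(** Mean value theorem on the segment joining the two points, which lies in [J] because [J] is an
    interval. *)
Lemma is_derivative_on_0_cst f s t :
  is_derivative_on J f (cst 0) -> J s -> J t -> f s = f t.
Proof.
move=> Df.
wlog st : s t / s < t.
  move=> W Js Jt; have [st|ts|->//] := ltgtP s t; first exact: W.
  by rewrite (W t s).
move=> Js Jt.
have [x||c _] := @MVT _ f (cst 0) s t st.
- by move=> xst; exact: is_derivative_on_interior Js Jt xst Df.
- apply/subspace_continuousP => u; rewrite /= in_itv /= => /andP[su ut] A Au.
  have Ju : J u by apply: (@itvJ s t) => //; rewrite su.
  have := is_derivative_on_continuous Df Ju Au.
  rewrite /= !near_simpl !near_withinE => fA.
  near=> v; rewrite /= in_itv /= => /andP[sv vt].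
  (* The available limit is over punctured neighbourhoods, so the centre [u] is treated apart. *)
  have [->|vu] := eqVneq v u; first exact: nbhs_singleton.
  have : v != u -> J v -> A (f v) by near: v.
  by apply=> //; apply: (@itvJ s t) => //; rewrite sv.
- by move/eqP; rewrite mul0r subr_eq0 => /eqP.
Unshelve. all: by end_near. Qed.

End DerivativeOn.

(** * Weighted elementary symmetric sums over subsets of the variables *)

Section SetESP.
Variables (K : comNzRingType) (n : nat).
Implicit Types (A : {set 'I_n}) (c : nat -> K) (x : 'I_n -> K).

(* The sum of [c k * sigma_k] over the variables [x j], [j \in A]. *)
Definition esp A c x : K :=
  \sum_(h : {set 'I_n} | h \subset A) c #|h| * \prod_(j in h) x j.

(** This is the affine dependence on [x i]. Subsets avoiding [i] give the first term; the others are
    [i |: h] with [h] inside [A :\ i], and the extra element shifts the index of [c] by one. *)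
Lemma espD1 A i c x : i \in A ->
  esp A c x = esp (A :\ i) c x + x i * esp (A :\ i) (c \o S) x.
Proof.
move=> iA; rewrite /esp (bigID (fun h : {set 'I_n} => i \notin h)) /=; congr (_ + _).
  by apply: eq_bigl => h; rewrite subsetD1.
rewrite mulr_sumr (reindex_onto (fun h => i |: h) (fun h => h :\ i)) /=; last first.
  by move=> h /andP[_]; rewrite negbK => ih; exact: finset.setD1K.
apply: eq_big => [h|h /andP[/andP[_ _] /eqP hi]].
  rewrite subsetD1 finset.subUset finset.sub1set iA setU11 /= andbT.
  congr (_ && _); apply/eqP/idP => [<-|/setU1K//].
  by rewrite setD11.
have nih : i \notin h by rewrite -hi setD11.
by rewrite cardsU1 nih big_setU1//= mulrCA.
Qed.

Lemma esp_rec A c x (a0 a1 : K) :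
  (forall k, (k <= #|A|)%N -> c k = a1 * c k.+1 - a0 * c k.+2) ->
  esp A c x = a1 * esp A (c \o S) x - a0 * esp A (c \o S \o S) x.
Proof.
move=> hc; rewrite /esp !mulr_sumr -sumrB; apply: eq_bigr => h hA /=.
by rewrite hc ?subset_leq_card//; ring.
Qed.

(* With [A' = esp (A :\ i) c x], etc., the recurrence gives
   [u = (a1 + x i) * B' - a0 * C'] and [v = B' + x i * C'], so that passing from
   [A :\ i] to [A] multiplies by an element of norm [x i ^+ 2 + a1 * x i + a0]. *)
Lemma esp_norm A c x (a0 a1 : K) :
  (forall k, (k < #|A|)%N -> c k = a1 * c k.+1 - a0 * c k.+2) ->
  let u := esp A c x in let v := esp A (c \o S) x in
  u ^+ 2 - a1 * u * v + a0 * v ^+ 2 =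
  (c #|A| ^+ 2 - a1 * c #|A| * c #|A|.+1 + a0 * c #|A|.+1 ^+ 2)
  * \prod_(j in A) (x j ^+ 2 + a1 * x j + a0).
Proof.
move Em : #|A| => m; elim: m A c Em => [|m IHm] A c Em hc /=.
  have -> : A = finset.set0 by apply/eqP; rewrite -cards_eq0 Em.
  have esp0 d : esp finset.set0 d x = d 0%N.
    rewrite /esp (big_pred1 finset.set0) => [|h]; last by rewrite finset.subset0.
    by rewrite cards0 big_set0 mulr1.
  by rewrite !esp0 big_set0 mulr1.
have [i iA] : exists i, i \in A by apply/set0Pn; rewrite -card_gt0 Em.
have Em' : #|A :\ i| = m by move: Em; rewrite (cardsD1 i) iA => -[].
rewrite (big_setD1 i)//= !(@espD1 A i)// (@esp_rec (A :\ i) c x a0 a1); last first.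
  by move=> k; rewrite Em' => km; exact: hc.
(* The induction runs on the shifted coefficients: their values at [m] and [m.+1] are those of [c]
   at [m.+1] and [m.+2], as the conclusion for [A] requires. *)
have /= := IHm (A :\ i) (c \o S) Em' (fun k km => hc k.+1 km).
by move=> IH; rewrite [RHS]mulrCA -IH; ring.
Qed.

End SetESP.

(** * The polynomial [F] and its partial derivatives as subset sums *)

Section Fpoly.
Variables (R : realType) (n : nat) (c : nat -> R).

(** After exchanging the sums, each subset [h] meets the single index [k = #|h|]. Staying in the
    polynomial ring lets [espD1] be differentiated formally. *)
Lemma Fpoly_esp :
  Fpoly n c = esp finset.setT (fun k => mpolyC n (c k)) (fun i => mpolyX R (mnm1 i)).
Proof.
rewrite /Fpoly /esp.
under eq_bigr do rewrite /mesym scaler_sumr.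
rewrite (exchange_big_dep xpredT)//=.
apply: eq_big => [h|h _]; first by rewrite finset.subsetT.
have hn : (#|h| < n.+1)%N by rewrite ltnS -[X in (_ <= X)%N]card_ord max_card.
rewrite (big_pred1 (Ordinal hn)) /=; first by rewrite mul_mpolyC.
by move=> k; rewrite eq_sym.
Qed.

Lemma meval_esp (A : {set 'I_n}) (d : nat -> R) (x : 'I_n -> R) :
  meval x (esp A (fun k => mpolyC n (d k)) (fun i => mpolyX R (mnm1 i)))
  = esp A d x.
Proof.
rewrite /esp raddf_sum; apply: eq_bigr => h _ /=.
rewrite rmorphM rmorph_prod /= mevalC; congr (_ * _).
by apply: eq_bigr => j _; rewrite mevalXU.
Qed.

Lemma mderiv_esp (A : {set 'I_n}) i (d : nat -> R) : i \notin A ->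
  mderiv i (esp A (fun k => mpolyC n (d k)) (fun i => mpolyX R (mnm1 i))) = 0.
Proof.
move=> iA; rewrite /esp raddf_sum big1// => h hA /=.
rewrite mderiv_mulC (_ : mderiv i _ = 0) ?mulr0//.
apply: (big_ind (fun q => mderiv i q = 0)) => [|q1 q2 q10 q20|j jh].
- by rewrite -mpolyC1 mderivC.
- by rewrite mderivM q10 q20 mul0r mulr0 addr0.
- rewrite mderivXU; have [ji|//] := eqVneq j i.
  by move: iA; rewrite -ji (fintype.subsetP hA).
Qed.

Lemma Feval_esp (x : 'I_n -> R) : Feval c x = esp finset.setT c x.
Proof. by rewrite /Feval Fpoly_esp meval_esp. Qed.

(** In the decomposition [A + X_i B] given by [espD1], neither [A] nor [B] contains [X_i], so the
    derivative is [B]. *)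
Lemma dFeval_esp i (x : 'I_n -> R) : dFeval c i x = esp (finset.setT :\ i) (c \o S) x.
Proof.
rewrite /dFeval Fpoly_esp (@espD1 _ _ _ i) ?finset.in_setT// mderivD.
rewrite mderivM !mderiv_esp ?setD11// mulr0 addr0 add0r.
rewrite mderivXU eqxx mul1r.
exact: (meval_esp _ (c \o S)).
Qed.

End Fpoly.

(** * Algebraic identities for the derivative of [xi_i] *)

Section Identities.
Variables (R : realType) (n : nat) (a0 a1 : R) (c : nat -> R).
Hypothesis hc : forall k, (0 < k < n)%N -> c k.-1 = a1 * c k - a0 * c k.+1.
Variable x : 'I_n -> R.

(* [velocity i] is the value of [xi_i'] once [p_i''] is eliminated. *)
Definition velocity i : R :=
  2 * x i + a1 - 2 * (x i ^+ 2 + a1 * x i + a0) * dFeval c i x / Feval c x.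

Hypothesis F0 : Feval c x != 0.

(** Splitting off both variables gives [F = a + (x_i + x_j) b + x_i x_j d], with partial derivatives
    [b + x_j d] and [b + x_i d]. Substituting [a = a1 b - a0 d] reduces the claim to a rational
    identity. *)
Lemma velocity_indep i j : velocity i = velocity j.
Proof.
have [->//|ij] := eqVneq i j.
have := F0; rewrite /velocity.
rewrite !dFeval_esp Feval_esp.
have ji : j != i by rewrite eq_sym.
pose B : {set 'I_n} := (finset.setT :\ i) :\ j.
have cB : #|B|.+2 = n.
  rewrite -[RHS]card_ord -cardsT (cardsD1 i) (cardsD1 j (_ :\ i)).
  by rewrite !finset.in_setT in_setD1 ji finset.in_setT.
have eB : (finset.setT :\ j) :\ i = B by rewrite /B !finset.setDDl finset.setUC.
rewrite (@espD1 _ _ _ i) ?finset.in_setT//.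
rewrite !(@espD1 _ _ (_ :\ i) j) ?in_setD1 ?ji ?finset.in_setT//.
rewrite (@espD1 _ _ (_ :\ j) i) ?in_setD1 ?ij ?finset.in_setT// eB -/B.
rewrite (@esp_rec _ _ B c x a0 a1); last first.
  (* [B] has [n - 2] elements, so [k.+1] runs exactly over the range of the recurrence. *)
  by move=> k kB; apply: (@hc k.+1); rewrite -cB !ltnS.
set b := esp _ _ _; set d := esp _ _ _ => ?.
by field.
Qed.

Lemma velocity_sqr i :
  velocity i ^+ 2 = a1 ^+ 2 - 4 * a0 +
  4 / Feval c x ^+ 2 * (c n.-1 ^+ 2 - a1 * c n.-1 * c n + a0 * c n ^+ 2)
  * \prod_j (x j ^+ 2 + a1 * x j + a0).
Proof.
have n0 : (0 < n)%N := leq_ltn_trans (leq0n i) (ltn_ord i).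
have cA : #|finset.setT :\ i| = n.-1.
  by have := cardsD1 i finset.setT; rewrite finset.in_setT cardsT card_ord => /(congr1 predn).
(* The norm formula is applied to the [n - 1] variables other than [x i], which is why [c n.-1] and
   [c n] appear; the factor at [i] comes from completing the square. *)
have := @esp_norm _ _ (finset.setT :\ i) c x a0 a1.
rewrite cA prednK// => /(_ _)/= N.
rewrite (bigD1 i)//= mulrACA.
have -> : \prod_(j < n | j != i) (x j ^+ 2 + a1 * x j + a0) =
  \prod_(j in finset.setT :\ i) (x j ^+ 2 + a1 * x j + a0).
  by apply: eq_bigl => j; rewrite !inE andbT.
rewrite -N; last first.
  by move=> k kn; apply: (@hc k.+1); rewrite /= -(prednK n0) ltnS.
have := F0; rewrite /velocity dFeval_esp Feval_esp (@espD1 _ _ finset.setT i) ?finset.in_setT// => ?.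
by field.
Qed.

End Identities.

(** * Differentiation along a solution *)

Section Solution.
Variables (R : realType) (n : nat) (c : nat -> R) (J : set R).
Variables p p' p'' : 'I_n -> R -> R.
Hypotheses (itvJ : is_interval J) (sol : is_solution c J p p' p'').

Lemma sol_p''E i s : J s ->
  p'' i s = 2 * p' i s ^+ 2 * dFeval c i (p ^~ s) / Feval c (p ^~ s).
Proof.
move=> Js; have F0 := sol_F_neq0 sol Js.
apply: (mulIf F0); rewrite divfK//.
by rewrite -mulrA -(sol_ode sol i Js); field.
Qed.

(** The logarithmic derivative of [F] is the sum of the [L i], and that of [1 / p'_i] is [- 2 * L i]
    by the equation; hence [F ^+ 2] times the product of the [1 / p'_i] has zero derivative. *)
Lemma F2_first_integral : exists kappa : R, forall s, J s ->
  Feval c (p ^~ s) ^+ 2 = kappa * \prod_(j < n) p' j s.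
Proof.
have [[s0 Js0]|J0] := pselect (exists s, J s); last first.
  by exists 0 => s Js; case: J0; exists s.
pose F s := Feval c (p ^~ s); pose L i s := dFeval c i (p ^~ s) / F s * p' i s.
have DF : is_derivative_on J F ((fun s => \sum_i L i s) \* F).
  apply: is_derivative_on_ext (is_derivative_on_meval (q := Fpoly n c) (sol_deriv1 sol)) => // s.
  rewrite inE => Js /=; rewrite mulr_suml; apply: eq_bigr => i _.
  by rewrite /L mulrAC divfK ?(sol_F_neq0 sol)// mulrC.
have DV i : is_derivative_on J (fun s => (p' i s)^-1)
    ((fun s => - 2 * L i s) \* (fun s => (p' i s)^-1)).
  have pn0 := sol_p'_neq0 sol i.
  apply: is_derivative_on_ext (is_derivative_onV pn0 (sol_deriv2 (i := i) sol)) => // s.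
  rewrite inE => Js /=; rewrite sol_p''E// /L /F; field.
  by rewrite pn0// (sol_F_neq0 sol).
pose w s := F s * F s * \prod_i (p' i s)^-1.
have Dw : is_derivative_on J w (cst 0).
  have := is_derivative_onM (is_derivative_onM DF DF)
    (is_derivative_on_prod (r := index_enum 'I_n) DV).
  apply: is_derivative_on_ext => // s _ /=.
  by rewrite -mulr_sumr; ring.
exists (w s0) => s Js.
rewrite (is_derivative_on_0_cst itvJ Dw Js0 Js) /w -mulrA -big_split /=.
by rewrite big1 ?mulr1 ?expr2// => i _; rewrite mulVf// (sol_p'_neq0 sol).
Qed.

Lemma xi_derivative (a0 a1 : R) i :
  is_derivative_on J (fun s => xi a0 a1 i (p ^~ s) (p' ^~ s))
    (fun s => velocity a0 a1 c (p ^~ s) i).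
Proof.
have Dp := sol_deriv1 (i := i) sol; have Cst a := is_derivative_on_cst (J := J) a.
have DQ := is_derivative_onD (is_derivative_onD
  (is_derivative_onM Dp Dp) (is_derivative_onM (Cst a1) Dp)) (Cst a0).
have pn0 := sol_p'_neq0 sol i.
apply: is_derivative_on_ext (is_derivative_onM DQ
  (is_derivative_onV pn0 (sol_deriv2 (i := i) sol))) => s; rewrite inE => Js //=.
rewrite sol_p''E// /velocity; field.
by rewrite pn0// (sol_F_neq0 sol).
Qed.

End Solution.

(** * The first integrals and the equation for the squared derivatives *)

Unset Implicit Arguments.

Theorem theorem5p5 (R : realType) (n : nat) (hn : (0 < n)%N) (a0 a1 : R)
    (c : nat -> R)
    (hc : forall k : nat, (0 < k < n)%N -> c k.-1 = a1 * c k - a0 * c k.+1) :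
  (forall i : 'I_n, (0 < i)%N ->
     is_first_integral c
       (fun x y : 'I_n -> R => xi a0 a1 i x y - xi a0 a1 (Ordinal hn) x y)) /\
  (forall (J : set R) (p p' p'' : 'I_n -> R -> R),
     proper_interval J -> is_solution c J p p' p'' ->
     let F2_eq (kappa : R) :=
       forall s : R, J s -> Feval c (p ^~ s) ^+ 2 = kappa * \prod_(j < n) p' j s in
     let Xi (i : 'I_n) (s : R) := xi a0 a1 i (p ^~ s) (p' ^~ s) in
     (exists kappa : R, F2_eq kappa) /\
     (forall kappa : R, F2_eq kappa ->
        forall i : 'I_n, exists dXi : R -> R,
          is_derivative_on J (Xi i) dXi /\
          forall s : R, J s ->
            dXi s ^+ 2 =
              (a1 ^+ 2 - 4 * a0)
              + 4 / kappa
                * (c n.-1 ^+ 2 - a1 * c n.-1 * c n + a0 * c n ^+ 2)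
                * \prod_(j < n) Xi j s)).
Proof.
split=> [i _ J p p' p'' [itvJ _] sol s t Js Jt|J p p' p'' [itvJ _] sol F2_eq Xi].
  have Di k := xi_derivative (a0 := a0) (a1 := a1) (i := k) sol.
  have Dm := is_derivative_onM (is_derivative_on_cst (J := J) (-1)) (Di (Ordinal hn)).
  have D := is_derivative_onD (Di i) Dm.
  have D0 : is_derivative_on J (fun s =>
    xi a0 a1 i (p ^~ s) (p' ^~ s) - xi a0 a1 (Ordinal hn) (p ^~ s) (p' ^~ s)) (cst 0).
    apply: is_derivative_on_ext D => u; rewrite inE => Ju /=; first by rewrite mulN1r.
    (* Both terms have the same derivative, so their difference has derivative zero. *)
    by rewrite (velocity_indep hc (sol_F_neq0 sol Ju) i (Ordinal hn)) /=; ring.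
  exact: (is_derivative_on_0_cst itvJ D0 Js Jt).
split; first exact: F2_first_integral itvJ sol.
move=> kappa Hk i; exists (fun s => velocity a0 a1 c (p ^~ s) i); split.
  exact: (xi_derivative (i := i) sol).
move=> s Js; have F0 := sol_F_neq0 sol Js.
(* Replacing [F ^+ 2] by [kappa] times the product of the [p' j] supplies the denominators that turn
   the quadratic factors into the [Xi j]. *)
rewrite velocity_sqr// /Xi /xi prodf_div Hk//.
have P0 : \prod_(j < n) p' j s != 0.
  by apply/prodf_neq0 => j _; exact: (sol_p'_neq0 sol).
(* A zero [kappa] would force [F] to vanish at [s], so [4 / kappa] is a genuine quotient. *)
have k0 : kappa != 0 by apply: contraNneq F0 => k0; rewrite -sqrf_eq0 Hk// k0 mul0r.
by field; rewrite k0 P0.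
Qed.
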